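(* Let $f:[\omega_2]^2\rightarrow[\omega_2]^{\leq\omega}$ have the property $\Delta$, and let $p_1=(D_1,h_1,i_1)$, $p_2=(D_2,h_2,i_2)\in\mathbb{P}_f$ be two isomorphic conditions such that $p_1$ is lower than $p_2$. Let $e:D_1\rightarrow D_2$ be the order-preserving bijective function and assume that (A) if $\xi,\eta\in D_1\cap D_2$ and $\xi\neq\eta$, then $i_1(\{\xi,\eta\})=i_2(\{\xi,\eta\})$; (B) for all $\zeta\in D_1\cap D_2$, all $\xi\in D_1\setminus D_2$ and all $\eta\in D_2\setminus D_1$: (i) if $\zeta<\xi$, then $f(\{\zeta,\eta\})\subseteq f(\{\xi,\eta\})$; (ii) $D_1\cap\xi\cap\eta\subseteq f(\{\xi,\eta\})$. Then there is $q=(D_q,h_q,i_q)\in\mathbb{P}_f$ with $q\leq p_1,p_2$ such that for all $\xi\in D_1$ and all $\eta\in D_2$: $\xi\in h_q(\eta)$ if and only if $e(\xi)\in h_2(\eta)$.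
   Context: Ordinals are identified with the sets of smaller ordinals; $\wp(X)$ is the power set of $X$. Property $\Delta$. A function $f:[\omega_2]^2\rightarrow[\omega_2]^{\leq\omega}$ has the property $\Delta$ if $f(\{\xi,\eta\})\subseteq\min\{\xi,\eta\}$ for all $\{\xi,\eta\}\in[\omega_2]^2$ and for any uncountable family $\mathcal{A}$ of finite subsets of $\omega_2$ there are distinct $a,b\in\mathcal{A}$ such that for any $\tau\in a\cap b$, $\xi\in a\setminus b$, $\eta\in b\setminus a$: 1) $a\cap b\cap\min\{\xi,\eta\}\subseteq f(\{\xi,\eta\})$; 2) $\tau<\xi\Rightarrow f(\{\tau,\eta\})\subseteq f(\{\xi,\eta\})$; 3) $\tau<\eta\Rightarrow f(\{\tau,\xi\})\subseteq f(\{\xi,\eta\})$. The forcing $\mathbb{P}_f$. Conditions are triples $p=(D_p,h_p,i_p)$ where: 1. $D_p\in[\omega_2]^{<\omega}$; 2. $h_p:D_p\rightarrow\wp(D_p)$ and $\max h_p(\xi)=\xi$ for all $\xi\in D_p$; 3. $i_p:[D_p]^2\rightarrow[D_p]^{<\omega}$ and for all $\xi<\eta$ in $D_p$: (a) if $\xi\in h_p(\eta)$, then $h_p(\xi)\setminus h_p(\eta)\subseteq\bigcup_{\gamma\in i_p(\{\xi,\eta\})}h_p(\gamma)$; (b) if $\xi\notin h_p(\eta)$, then $h_p(\xi)\cap h_p(\eta)\subseteq\bigcup_{\gamma\in i_p(\{\xi,\eta\})}h_p(\gamma)$; (c) $i_p(\{\xi,\eta\})\subseteq f(\{\xi,\eta\})$.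 The order: $p\leq q$ if $D_p\supseteq D_q$, $h_p(\xi)\cap D_q=h_q(\xi)$ for all $\xi\in D_q$, and $i_p|_{[D_q]^2}=i_q$. Isomorphic conditions. $p_1$ and $p_2$ are isomorphic if there is an order-preserving bijection $e:D_1\rightarrow D_2$ such that (a) for $\xi,\eta\in D_1$, $\xi\in h_1(\eta)$ if and only if $e(\xi)\in h_2(e(\eta))$; (b) if $\xi\in D_1\cap D_2$, then $e(\xi)=\xi$. In this case, if $\xi\leq e(\xi)$ for every $\xi\in D_1$, then $p_1$ is said to be lower than $p_2$.
   Formalization: Condition (B)(ii) is required for all ξ in D_1∖D_2 and η in D_2∖D_1 even when D_1∩D_2 is empty; read literally, (B) would then be vacuous and the claim would fail. *)

(* Defs.v *)
From HB Require Import structures.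
From mathcomp Require Import all_boot all_order.
From mathcomp Require Import finmap.
From mathcomp Require Import boolp classical_sets functions cardinality wochoice.

Set Implicit Arguments.
Unset Strict Implicit.
Unset Printing Implicit Defensive.

Import Order.TTheory.

Local Open Scope order_scope.
Local Open Scope fset_scope.
Local Open Scope classical_set_scope.
Local Open Scope card_scope.

(* The ordinal x, identified with the set of smaller ordinals. *)
Definition seg d (T : orderType d) (x : T) : set T := [set y | y < x].

(* The order type of T is the least ordinal that does not inject into K, i.e.
   the cardinal successor of the cardinality of an infinite K. *)
Definition is_succ_cardinal (K : Type) d (T : orderType d) : Prop :=
  [/\ well_order (<=%O : rel T),
      ~ ([set: T] #<= [set: K]) &
      forall x : T, seg x #<= [set: K]].

Definition is_omega1 d (T : orderType d) : Prop := is_succ_cardinal nat T.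

(* Determines T up to a unique order isomorphism. *)
Definition is_omega2 d (T : orderType d) : Prop :=
  exists (d1 : Order.disp_t) (W1 : orderType d1),
    is_omega1 W1 /\ is_succ_cardinal W1 T.

Section Forcing.
Context {d : Order.disp_t} {T : orderType d}.
Implicit Types (x y z xi eta zeta tau : T) (e : T -> T).

(* Functions on [X]^2 are total functions on {fset T}, of which only the values
   at the pairs [fset x; y] with x != y in X are ever used. *)

Definition property_Delta (f : {fset T} -> set T) : Prop :=
  [/\ forall xi eta, xi != eta -> countable (f [fset xi; eta]),
      forall xi eta, xi != eta -> f [fset xi; eta] `<=` seg (Order.min xi eta) &
      forall A : set {fset T}, ~ countable A ->
        exists a b : {fset T}, [/\ A a, A b, a != b &
          forall tau xi eta, tau \in (a `&` b)%fset -> xi \in (a `\` b)%fset ->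
            eta \in (b `\` a)%fset ->
          [/\ [set` (a `&` b)%fset] `&` seg (Order.min xi eta) `<=` f [fset xi; eta],
              tau < xi -> f [fset tau; eta] `<=` f [fset xi; eta] &
              tau < eta -> f [fset tau; xi] `<=` f [fset xi; eta]]]].

(* Only the values of hfun on dom, and of ifun on [dom]^2, are meaningful. *)
Record condition := Condition {
  dom : {fset T};
  hfun : T -> {fset T};
  ifun : {fset T} -> {fset T} }.

Implicit Types p q : condition.

Definition is_max (A : {fset T}) x : Prop :=
  x \in A /\ forall y, y \in A -> y <= x.

Definition in_forcing (f : {fset T} -> set T) p : Prop :=
  let D := dom p in let h := hfun p in let i := ifun p in
  [/\ forall xi, xi \in D -> h xi `<=` D /\ is_max (h xi) xi,
      forall xi eta, xi \in D -> eta \in D -> xi != eta ->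
        i [fset xi; eta] `<=` D &
      forall xi eta, xi \in D -> eta \in D -> xi < eta ->
        [/\ xi \in h eta ->
              h xi `\` h eta `<=` \bigcup_(g <- i [fset xi; eta]) h g,
            xi \notin h eta ->
              h xi `&` h eta `<=` \bigcup_(g <- i [fset xi; eta]) h g &
            ([set` i [fset xi; eta]] `<=` f [fset xi; eta])%classic]]%fset.

Definition cond_le p q : Prop :=
  [/\ dom q `<=` dom p,
      forall xi, xi \in dom q -> hfun p xi `&` dom q = hfun q xi &
      forall xi eta, xi \in dom q -> eta \in dom q -> xi != eta ->
        ifun p [fset xi; eta] = ifun q [fset xi; eta]]%fset.

Definition order_bij e (D1 D2 : {fset T}) : Prop :=
  set_bij [set` D1] [set` D2] e /\
  {in D1 &, {homo e : x y / x < y}}.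

Definition iso_by e p1 p2 : Prop :=
  [/\ order_bij e (dom p1) (dom p2),
      forall xi eta, xi \in dom p1 -> eta \in dom p1 ->
        (xi \in hfun p1 eta <-> e xi \in hfun p2 (e eta)) &
      forall xi, xi \in dom p1 `&` dom p2 -> e xi = xi]%fset.

Definition isomorphic p1 p2 : Prop := exists e, iso_by e p1 p2.

Definition lower p1 p2 : Prop :=
  exists e, iso_by e p1 p2 /\ forall xi, xi \in dom p1 -> xi <= e xi.

End Forcing.

Arguments condition {d} T.

(* Main.v *)
Require Import Defs.
From HB Require Import structures.
From mathcomp Require Import all_boot all_order.
From mathcomp Require Import finmap.
From mathcomp Require Import boolp classical_sets functions cardinality wochoice.

(** The condition [q] lives on [D1 `|` D2], and each [h_q eta] is the preimage
    of some [h1 eta] or [h2 eta] under a map that collapses the union onto [D1]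
    or onto [D2].

    Onto [D2] the map is forced by the last clause of the theorem: it is [e] on
    [D1] and the identity elsewhere.  Onto [D1] it is the identity on [D1] and
    sends [x] in [D2 `\` D1] to the least common [zeta] with [x] in [h2 zeta].
    Neither map moves a relevant point down, [p1] being lower than [p2], so
    [eta] stays the maximum of [h_q eta].  On a common [eta] the two preimages
    agree: if [zeta < eta] is the image of [x] and [h2 eta] told [x] and [zeta]
    apart, then the covering clause of [p2] for [zeta < eta] would put [x] in
    some [h2 gamma] with [gamma] in [i2 [fset zeta; eta]].  By (A) this set is [i1 [fset zeta; eta]], so [gamma]
    is common, and it is below [zeta] because [f] takes values below the
    minimum; this contradicts the choice of [zeta] (lemma [collapse1_common]).

    Since the collapses are the identity on their targets, the covering clauses
    for pairs inside [D1] or inside [D2] are pulled back from [p1] and [p2].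
    For a mixed pair [xi] in [D1 `\` D2], [eta] in [D2 `\` D1] the value of
    [i_q] is as large as possible, namely the whole trace of [f [fset xi; eta]]
    on the union.  A point [x] of [D1] in need of covering covers itself by
    (B)(ii).  For [x] in [D2 `\` D1] and [xi < eta], the image of [x] covers it
    for the same reason.  For [eta < xi], the failure means that [x] and [eta]
    are collapsed to points that [h1 xi] tells apart, hence some common
    [zeta < xi] has [h2 zeta] telling [x] and [eta] apart (lemma
    [collapse1_separation]); either [zeta < eta] covers [x] itself, or the
    covering clause of [p2] for [eta < zeta] produces a point of
    [f [fset zeta; eta]], which (B)(i) places in [f [fset xi; eta]].

    The bijection of the theorem and the one witnessing that [p1] is lower than
    [p2] coincide on [D1], finite linear orders having no other isomorphism
    (lemma [order_bij_uniq]). *)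

Set Implicit Arguments.
Unset Strict Implicit.
Unset Printing Implicit Defensive.

Import Order.TTheory.

Local Open Scope order_scope.
Local Open Scope fset_scope.
Local Open Scope classical_set_scope.

(** * Finite subsets of a linear order, and the covering clauses *)

Lemma fset_least d (T : orderType d) (A : {fset T}) (a : T) : a \in A ->
  exists2 z, z \in A & forall y, y \in A -> z <= y.
Proof.
move=> aA; have memA y : (y \in sort <=%O A) = (y \in A) by rewrite mem_sort.
have := sort_le_sorted A; case: (sort _ _) memA => [|z s] memA.
  by move: (memA a); rewrite aA.
rewrite /= => /(order_path_min le_trans)/allP zs.
exists z; first by rewrite -memA mem_head.
by move=> y; rewrite -memA inE => /predU1P[->//|/zs].
Qed.

Section Preliminaries.
Context {d : Order.disp_t} {T : orderType d}.
Implicit Types (x y z xi eta zeta gamma : T) (e : T -> T) (p : condition T).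

(** Both bijections list [D2] increasingly along the increasing list of [D1]. *)
Lemma order_bij_uniq e e' (D1 D2 : {fset T}) :
  order_bij e D1 D2 -> order_bij e' D1 D2 -> {in D1, e =1 e'}.
Proof.
have sorted_image g : order_bij g D1 D2 ->
    map g (sort <=%O D1) = sort <=%O D2.
  move=> [[gD _ gonto] gmono]; apply: lt_sorted_eq.
  - apply: (homo_sorted_in gmono); first by apply/allP => x; rewrite mem_sort.
    by rewrite sort_lt_sorted fset_uniq.
  - by rewrite sort_lt_sorted fset_uniq.
  - move=> y; rewrite mem_sort; apply/mapP/idP => [[x]|/gonto[x xD <-]].
      by rewrite mem_sort => xD ->; apply: gD.
    by exists x => //; rewrite mem_sort.
move=> /sorted_image eE /sorted_image e'E x xD.
have /eq_in_map : map e (sort <=%O D1) = map e' (sort <=%O D1) by rewrite eE.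
by apply; rewrite mem_sort.
Qed.

(** The covering clauses (a) and (b) have a common form: a point of [h xi]
    needs covering exactly when [h eta] tells it apart from [xi]. *)
Definition covered (h : T -> {fset T}) (g : {fset T}) xi eta : Prop :=
  forall x, x \in h xi -> (xi \in h eta) != (x \in h eta) ->
    exists2 gamma, gamma \in g & x \in h gamma.

Lemma coveredP (h : T -> {fset T}) (g : {fset T}) xi eta :
  covered h g xi eta <->
  ((xi \in h eta -> h xi `\` h eta `<=` \bigcup_(z <- g) h z) /\
   (xi \notin h eta -> h xi `&` h eta `<=` \bigcup_(z <- g) h z))%fset.
Proof.
split=> [cov | [cova covb] x xh].
  split=> hxi; apply/fsubsetP => x; rewrite inE => /andP[].
    move=> xeta xxi; apply/bigfcupP.
    have [|z zg xz] := cov x xxi; first by rewrite hxi (negbTE xeta).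
    by exists z; rewrite ?zg.
  move=> xxi xeta; apply/bigfcupP.
  have [|z zg xz] := cov x xxi; first by rewrite xeta (negbTE hxi).
  by exists z; rewrite ?zg.
have [hxi|hxi] := boolP (xi \in h eta) => xeta.
  have /(fsubsetP (cova hxi))/bigfcupP[z] : x \in (h xi `\` h eta)%fset.
    by rewrite inE xh andbT; case: (x \in h eta) xeta.
  by rewrite andbT => zg xz; exists z.
have /(fsubsetP (covb hxi))/bigfcupP[z] : x \in (h xi `&` h eta)%fset.
  by rewrite inE xh /=; case: (x \in h eta) xeta.
by rewrite andbT => zg xz; exists z.
Qed.

Lemma forcing_covered (f : {fset T} -> set T) p xi eta :
  in_forcing f p -> xi \in dom p -> eta \in dom p -> xi < eta ->
  covered (hfun p) (ifun p [fset xi; eta]%fset) xi eta.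
Proof. by move=> [_ _ H] xiD etaD /(H _ _ xiD etaD)[? ? _]; apply/coveredP. Qed.

Lemma fset2_sub (D : {fset T}) xi eta :
  ([fset xi; eta] `<=` D)%fset = (xi \in D) && (eta \in D).
Proof. by rewrite fsubUset !fsub1set. Qed.

End Preliminaries.

(** * The amalgam of two isomorphic conditions *)

Section Amalgam.
Context {d : Order.disp_t} {T : orderType d}.
Context (f : {fset T} -> set T) (p1 p2 : condition T) (e : T -> T).
Implicit Types x y z xi eta zeta gamma : T.

Let D1 := dom p1.
Let D2 := dom p2.
Let h1 := hfun p1.
Let h2 := hfun p2.

Definition least_common_above x z : Prop :=
  [/\ z \in (D1 `&` D2)%fset, x \in h2 z &
      forall y, y \in (D1 `&` D2)%fset -> x \in h2 y -> z <= y].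

(** The default value [x] is harmless: it lies outside [D1], hence in no
    [h1 eta], as it should when no common [h2 z] contains [x]. *)
Definition collapse1 x : T :=
  if x \in D1 then x else xget x [set z | least_common_above x z].

Definition collapse2 x : T := if x \in D1 then e x else x.

(** On a common [eta] either branch could be taken, by [collapse1_common]. *)
Definition amalgam_h eta : {fset T} :=
  [fset x in D1 `|` D2 | if eta \in D1 then collapse1 x \in h1 eta
                         else collapse2 x \in h2 eta]%fset.

(** Enlarging [i] only helps the covering clauses, so a mixed pair receives all
    that the bound [f] allows. *)
Definition amalgam_i (s : {fset T}) : {fset T} :=
  if (s `<=` D1)%fset then ifun p1 s
  else if (s `<=` D2)%fset then ifun p2 s
  else [fset x in D1 `|` D2 | x \in f s]%fset.

Definition amalgam : condition T :=
  Condition (D1 `|` D2)%fset amalgam_h amalgam_i.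

(** * Collapsing the union onto one domain *)

Context (f_below : forall xi eta, xi != eta ->
  f [fset xi; eta]%fset `<=` seg (Order.min xi eta)).
Context (Pp1 : in_forcing f p1) (Pp2 : in_forcing f p2).
Context (isoe : iso_by e p1 p2) (lowe : forall xi, xi \in D1 -> xi <= e xi).
Context (i_agree : forall xi eta,
  xi \in (D1 `&` D2)%fset -> eta \in (D1 `&` D2)%fset -> xi != eta ->
  ifun p1 [fset xi; eta]%fset = ifun p2 [fset xi; eta]%fset).

Lemma h1_sub x eta : eta \in D1 -> x \in h1 eta -> x \in D1.
Proof. by case: Pp1 => H _ _ /H[/fsubsetP H1 _] /H1. Qed.

Lemma h2_sub x eta : eta \in D2 -> x \in h2 eta -> x \in D2.
Proof. by case: Pp2 => H _ _ /H[/fsubsetP H2 _] /H2. Qed.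

Lemma h1_le x eta : eta \in D1 -> x \in h1 eta -> x <= eta.
Proof. by case: Pp1 => H _ _ /H[_ [_ H1]] /H1. Qed.

Lemma h2_le x eta : eta \in D2 -> x \in h2 eta -> x <= eta.
Proof. by case: Pp2 => H _ _ /H[_ [_ H2]] /H2. Qed.

Lemma h1_refl eta : eta \in D1 -> eta \in h1 eta.
Proof. by case: Pp1 => H _ _ /H[_ []]. Qed.

Lemma h2_refl eta : eta \in D2 -> eta \in h2 eta.
Proof. by case: Pp2 => H _ _ /H[_ []]. Qed.

Lemma e_sub x : x \in D1 -> e x \in D2.
Proof. by case: isoe => [[[eD _ _] _] _ _] /eD. Qed.

Lemma e_h x eta : x \in D1 -> eta \in D1 ->
  (e x \in h2 (e eta)) = (x \in h1 eta).
Proof. by case: isoe => _ H _ xD etaD; apply/idP/idP => /(H _ _ xD etaD). Qed.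

Lemma e_fix x : x \in D1 -> x \in D2 -> e x = x.
Proof. by case: isoe => _ _ H x1 x2; apply: H; rewrite inE x1. Qed.

Lemma collapse1_id x : x \in D1 -> collapse1 x = x.
Proof. by rewrite /collapse1 => ->. Qed.

Lemma collapse2_id x : x \in D2 -> collapse2 x = x.
Proof. by rewrite /collapse2; case: ifP => // x1 x2; apply: e_fix. Qed.

Variant collapse1_spec x : T -> Prop :=
| Collapsed z of least_common_above x z : collapse1_spec x z
| NotCollapsed of (forall z, z \in (D1 `&` D2)%fset -> x \notin h2 z) :
    collapse1_spec x x.

Lemma collapse1P x : x \notin D1 -> collapse1_spec x (collapse1 x).
Proof.
rewrite /collapse1 => /negbTE ->; case: xgetP => [z -> /= lz|noleast].
  exact: Collapsed.
apply: NotCollapsed => z zC; apply/negP => xz.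
have : z \in [fset y in D1 `&` D2 | x \in h2 y]%fset.
  by rewrite !inE /= -in_fsetI zC.
case/fset_least => y; rewrite !inE /= -in_fsetI => /andP[yC xy] ymin.
apply: (noleast y); split=> // t tC xt.
by apply: ymin; rewrite !inE /= -in_fsetI tC.
Qed.

(** The two preimages defining [amalgam_h] agree on [D1 `&` D2]: a point
    covering a disagreement would be a common point below the collapse of [x]
    whose [h2] still contains [x]. *)
Lemma collapse1_common x eta : x \in D2 ->
  x \notin D1 -> eta \in D1 -> eta \in D2 ->
  (collapse1 x \in h1 eta) = (x \in h2 eta).
Proof.
move=> xD2 xD1 eta1 eta2.
have h12 z : z \in D1 -> z \in D2 -> (z \in h1 eta) = (z \in h2 eta).
  by move=> z1 z2; rewrite -e_h // !e_fix.
have etaC : eta \in (D1 `&` D2)%fset by rewrite inE eta1.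
case: (collapse1P xD1) => [z [zC xz zmin]|nox]; last first.
  rewrite (negbTE (nox _ etaC)); apply/negbTE/negP => /(h1_sub eta1).
  by rewrite (negbTE xD1).
move: (zC); rewrite inE => /andP[z1 z2]; rewrite h12 //.
have [lt_z_eta|lt_eta_z|zE] := ltgtP z eta;
  last by rewrite zE h2_refl // -zE xz.
  apply/eqP; apply: contraT => differ.
  have nze : z != eta by rewrite lt_eqF.
  have [g gi xg] := forcing_covered Pp2 z2 eta2 lt_z_eta xz differ.
  have gC : g \in (D1 `&` D2)%fset.
    have [[_ /(_ z eta)s1 _] [_ /(_ z eta)s2 _]] := (Pp1, Pp2).
    rewrite inE (fsubsetP (s2 _ _ _)) // andbT.
    by rewrite (fsubsetP (s1 _ _ _)) // i_agree.
  have : g < z.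
    have [_ _ /(_ z eta z2 eta2 lt_z_eta)[_ _ /(_ g gi)]] := Pp2.
    by move/(f_below nze); rewrite /seg /= lt_min => /andP[].
  by rewrite ltNge zmin.
have -> : (x \in h2 eta) = false.
  by apply: contraTF lt_eta_z => /(zmin _ etaC); rewrite -leNgt.
by apply: contraTF lt_eta_z => /(h2_le eta2); rewrite -leNgt.
Qed.

(** Say that it is the collapse of [a] that [h1 xi] contains; it is then a
    common point below [xi].  If no common [zeta < xi] had an [h2 zeta] telling
    [a] and [b] apart, the same point would be the collapse of [b]. *)
Lemma collapse1_separation a b xi : a \notin D1 -> b \notin D1 ->
    xi \in D1 -> xi \notin D2 ->
    (collapse1 a \in h1 xi) != (collapse1 b \in h1 xi) ->
  exists zeta, [/\ zeta \in D1, zeta \in D2, zeta < xi &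
                   (a \in h2 zeta) != (b \in h2 zeta)].
Proof.
move=> + + xi1 xi2; wlog ain : a b / collapse1 a \in h1 xi.
  move=> H a1 b1 differ.
  have [ain|aout] := boolP (collapse1 a \in h1 xi); first exact: H.
  have bin : collapse1 b \in h1 xi.
    by move: differ; rewrite (negbTE aout); case: (_ \in _).
  have [|zeta [? ? ? ?]] := H b a bin b1 a1; first by rewrite eq_sym.
  by exists zeta; split=> //; rewrite eq_sym.
move=> a1 b1; rewrite ain; move: ain.
case: (collapse1P a1) => [z [zC az zmin] zxi|_ /(h1_sub xi1)]; last first.
  by rewrite (negbTE a1).
have [z1 z2] : z \in D1 /\ z \in D2 by apply/andP; rewrite -in_fsetI.
have ltzxi : z < xi.
  by rewrite lt_neqAle (h1_le xi1 zxi) andbT; apply: contraNneq xi2 => <-.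
have [bz|bz] := boolP (b \in h2 z); last first.
  by exists z; split; rewrite // az (negbTE bz).
case: (collapse1P b1) => [y [yC b_y ymin]|/(_ z zC)]; last by rewrite bz.
have [y1 y2] : y \in D1 /\ y \in D2 by apply/andP; rewrite -in_fsetI.
move=> yxi; have ltyz : y < z.
  by rewrite lt_neqAle ymin // andbT; apply: contraNneq yxi => ->; rewrite zxi.
exists y; split=> //; first exact: lt_trans ltzxi.
by rewrite b_y; apply: contraTneq ltyz => /(zmin _ yC); rewrite -leNgt.
Qed.

(** * Values of the amalgam, and covering within one domain *)

Lemma amalgam_hE1 x eta : eta \in D1 -> x \in (D1 `|` D2)%fset ->
  (x \in amalgam_h eta) = (collapse1 x \in h1 eta).
Proof. by move=> eta1 xD; rewrite !inE /= -in_fsetU xD eta1. Qed.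

Lemma amalgam_hE2 x eta : eta \in D2 -> x \in (D1 `|` D2)%fset ->
  (x \in amalgam_h eta) = (collapse2 x \in h2 eta).
Proof.
move=> eta2 xD; rewrite !inE /= -in_fsetU xD; case: ifP => //= eta1.
rewrite /collapse2; case: ifPn => x1; last first.
  by rewrite collapse1_common //; move: xD; rewrite inE (negbTE x1).
by rewrite collapse1_id // -e_h // (e_fix eta1 eta2).
Qed.

Lemma amalgam_hD x eta : x \in amalgam_h eta -> x \in (D1 `|` D2)%fset.
Proof. by rewrite !inE => /andP[]. Qed.

Lemma amalgam_i1 xi eta : xi \in D1 -> eta \in D1 ->
  amalgam_i [fset xi; eta]%fset = ifun p1 [fset xi; eta]%fset.
Proof. by move=> xi1 eta1; rewrite /amalgam_i fset2_sub xi1 eta1. Qed.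

Lemma amalgam_i2 xi eta : xi \in D2 -> eta \in D2 -> xi != eta ->
  amalgam_i [fset xi; eta]%fset = ifun p2 [fset xi; eta]%fset.
Proof.
move=> xi2 eta2 ne; rewrite /amalgam_i !fset2_sub xi2 eta2.
by case: ifP => // /andP[xi1 eta1]; rewrite i_agree // inE ?xi1 ?eta1.
Qed.

Lemma amalgam_i_mixed xi eta :
    xi \in D1 -> xi \notin D2 -> eta \in D2 -> eta \notin D1 ->
  amalgam_i [fset xi; eta]%fset =
  [fset x in D1 `|` D2 | x \in f [fset xi; eta]]%fset.
Proof.
move=> xi1 xi2 eta2 eta1; rewrite /amalgam_i !fset2_sub xi1 eta2.
by rewrite (negbTE xi2) (negbTE eta1).
Qed.

Lemma sub1 x : x \in D1 -> x \in (D1 `|` D2)%fset.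
Proof. by rewrite inE => ->. Qed.

Lemma sub2 x : x \in D2 -> x \in (D1 `|` D2)%fset.
Proof. by rewrite inE orbC => ->. Qed.

Lemma collapse1_ge x xi : xi \in D1 -> collapse1 x \in h1 xi ->
  x <= collapse1 x.
Proof.
have [x1|x1] := boolP (x \in D1); first by rewrite collapse1_id.
case: (collapse1P x1) => [z [+ xz _] _ _|//].
by rewrite inE => /andP[_ z2]; apply: h2_le.
Qed.

Lemma collapse2_ge x : x <= collapse2 x.
Proof. by rewrite /collapse2; case: ifP => // /lowe. Qed.

Lemma amalgam_h_le x eta : eta \in (D1 `|` D2)%fset ->
  x \in amalgam_h eta -> x <= eta.
Proof.
move=> etaD xeta; have xD := amalgam_hD xeta.
have [eta1|eta1] := boolP (eta \in D1).
  move: xeta; rewrite amalgam_hE1 // => xeta.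
  exact: le_trans (collapse1_ge eta1 xeta) (h1_le eta1 xeta).
have eta2 : eta \in D2 by move: etaD; rewrite inE (negbTE eta1).
move: xeta; rewrite amalgam_hE2 // => /(h2_le eta2).
exact: le_trans (collapse2_ge x).
Qed.

Lemma amalgam_h_refl eta : eta \in (D1 `|` D2)%fset -> eta \in amalgam_h eta.
Proof.
rewrite inE => /orP[eta1|eta2].
  by rewrite amalgam_hE1 ?sub1 // collapse1_id // h1_refl.
by rewrite amalgam_hE2 ?sub2 // collapse2_id // h2_refl.
Qed.

(** Every [gamma] in [i1 [fset xi; eta]] is in [D1], so covering in [p1] of the
    collapse of [x] by [gamma] is covering of [x] by [gamma] in the amalgam. *)
Lemma amalgam_covered1 xi eta : xi \in D1 -> eta \in D1 -> xi < eta ->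
  covered amalgam_h (amalgam_i [fset xi; eta]%fset) xi eta.
Proof.
move=> xi1 eta1 lt x xxi; have xD := amalgam_hD xxi; move: xxi.
rewrite amalgam_i1 // !amalgam_hE1 // ?sub1 // (collapse1_id xi1) => xxi.
case/(forcing_covered Pp1 xi1 eta1 lt xxi) => g gi xg; exists g => //.
rewrite amalgam_hE1 //; have [_ + _] := Pp1.
by move/(_ xi eta xi1 eta1); rewrite lt_eqF // => /(_ isT)/fsubsetP; apply.
Qed.

Lemma amalgam_covered2 xi eta : xi \in D2 -> eta \in D2 -> xi < eta ->
  covered amalgam_h (amalgam_i [fset xi; eta]%fset) xi eta.
Proof.
move=> xi2 eta2 lt x xxi; have xD := amalgam_hD xxi; move: xxi.
have ne : xi != eta by rewrite lt_eqF.
rewrite amalgam_i2 // !amalgam_hE2 // ?sub2 // (collapse2_id xi2) => xxi.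
case/(forcing_covered Pp2 xi2 eta2 lt xxi) => g gi xg; exists g => //.
rewrite amalgam_hE2 //; have [_ + _] := Pp2.
by move/(_ xi eta xi2 eta2 ne)/fsubsetP; apply.
Qed.

(** * Covering for mixed pairs *)

Context (f_mono : forall xi eta zeta, xi \in D1 -> xi \notin D2 ->
  eta \in D2 -> eta \notin D1 -> zeta \in D1 -> zeta \in D2 -> zeta < xi ->
  f [fset zeta; eta]%fset `<=` f [fset xi; eta]%fset).
Context (f_D1 : forall xi eta x, xi \in D1 -> xi \notin D2 ->
  eta \in D2 -> eta \notin D1 -> x \in D1 -> x < xi -> x < eta ->
  f [fset xi; eta]%fset x).

Section MixedPair.
Context (xi eta : T) (xi1 : xi \in D1) (xi2 : xi \notin D2).
Context (eta2 : eta \in D2) (eta1 : eta \notin D1).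

Lemma mixed_mem g : g \in (D1 `|` D2)%fset -> f [fset xi; eta]%fset g ->
  g \in amalgam_i [fset xi; eta]%fset.
Proof.
by move=> gD fg; rewrite amalgam_i_mixed // !inE /= -in_fsetU gD in_setE.
Qed.

(** This disposes of all the points of [D1]: one in need of covering lies in
    [amalgam_h] of the smaller of [xi] and [eta], hence is below both. *)
Lemma mixed_self_cover x : x \in D1 -> x < xi -> x < eta ->
  exists2 g, g \in amalgam_i [fset xi; eta]%fset & x \in amalgam_h g.
Proof.
move=> x1 xxi xeta; exists x; last by rewrite amalgam_h_refl ?sub1.
by apply: mixed_mem; [exact: sub1 | exact: f_D1].
Qed.

(** A point of [D2 `\` D1] enters [amalgam_h xi] only through its collapse,
    which is a common point below [xi], available by (B)(ii). *)
Lemma amalgam_covered_mixed12 : xi < eta ->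
  covered amalgam_h (amalgam_i [fset xi; eta]%fset) xi eta.
Proof.
move=> lt x xxi differ; have xD := amalgam_hD xxi.
have [x1|x1] := boolP (x \in D1).
  have ltx : x < xi.
    rewrite lt_neqAle (amalgam_h_le (sub1 xi1) xxi) andbT.
    by apply: contraNneq differ => ->.
  exact: mixed_self_cover x1 ltx (lt_trans ltx lt).
move: xxi; rewrite amalgam_hE1 //.
case: (collapse1P x1) => [z [+ xz _] zxi|_ /(h1_sub xi1)]; last first.
  by rewrite (negbTE x1).
rewrite inE => /andP[z1 z2].
have ltz : z < xi.
  by rewrite lt_neqAle (h1_le xi1 zxi) andbT; apply: contraNneq xi2 => <-.
exists z; last first.
  by rewrite amalgam_hE2 // /collapse2 (negbTE x1).
apply: mixed_mem; first exact: sub1.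
exact: f_D1 (lt_trans ltz lt).
Qed.

(** Here [x] and [eta] are told apart by [h2 z] for some common [z < xi].  For
    [z < eta], the point [eta] is too large for [h2 z], so [z] covers [x]; for
    [eta < z], condition (B)(i) lets [xi] inherit the cover that [p2] has for
    [eta] and [z]. *)
Lemma amalgam_covered_mixed21 : eta < xi ->
  covered amalgam_h (amalgam_i [fset xi; eta]%fset) eta xi.
Proof.
move=> lt x xeta differ; have xD := amalgam_hD xeta.
have [x1|x1] := boolP (x \in D1).
  have ltx : x < eta.
    rewrite lt_neqAle (amalgam_h_le (sub2 eta2) xeta) andbT.
    by apply: contraNneq eta1 => <-.
  exact: mixed_self_cover x1 (lt_trans ltx lt) ltx.
move: xeta differ; rewrite amalgam_hE2 // /collapse2 (negbTE x1) => xeta.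
rewrite !amalgam_hE1 // ?sub2 //.
case/(collapse1_separation eta1 x1 xi1 xi2) => z [z1 z2 ltz differ].
have [lt_z_eta|lt_eta_z|zE] := ltgtP z eta; last by move: eta1; rewrite -zE z1.
  exists z; first by apply: mixed_mem; [exact: sub1 | exact: f_D1].
  rewrite amalgam_hE2 // /collapse2 (negbTE x1); move: differ.
  have -> : (eta \in h2 z) = false.
    by apply: contraTF lt_z_eta => /(h2_le z2); rewrite -leNgt.
  by case: (x \in h2 z).
have [g gi xg] := forcing_covered Pp2 eta2 z2 lt_eta_z xeta differ.
have [_ gD2 /(_ eta z eta2 z2 lt_eta_z)[_ _ /(_ g gi)fg]] := Pp2.
have g2 : g \in D2 by apply: (fsubsetP (gD2 eta z _ _ _)) => //; rewrite lt_eqF.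
exists g; last by rewrite amalgam_hE2 // /collapse2 (negbTE x1).
apply: mixed_mem; first exact: sub2.
by apply: (f_mono xi1 xi2 eta2 eta1 z1 z2 ltz); rewrite fsetUC.
Qed.

End MixedPair.

(** * The amalgam is a condition extending both *)

Lemma amalgam_in_forcing : in_forcing f amalgam.
Proof.
have [_ i1D H1] := Pp1; have [_ i2D H2] := Pp2.
(* Up to symmetry of the pair, either both points lie in one of the two
   domains, or the first lies only in [D1] and the second only in [D2]. *)
have pair_ind (P : T -> T -> Prop) :
    (forall xi eta, xi \in D1 -> eta \in D1 -> P xi eta) ->
    (forall xi eta, xi \in D2 -> eta \in D2 -> P xi eta) ->
    (forall xi eta, xi \in D1 -> xi \notin D2 -> eta \in D2 -> eta \notin D1 ->
       P xi eta /\ P eta xi) ->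
  forall xi eta, xi \in (D1 `|` D2)%fset -> eta \in (D1 `|` D2)%fset ->
    P xi eta.
  move=> P1 P2 P12 xi eta; rewrite !inE.
  have [xi1|xi1] := boolP (xi \in D1); have [eta1|eta1] := boolP (eta \in D1).
  - by move=> _ _; apply: P1.
  - move=> _ /= eta2; have [xi2|xi2] := boolP (xi \in D2); first exact: P2.
    by have [] := P12 _ _ xi1 xi2 eta2 eta1.
  - move=> /= xi2 _; have [eta2|eta2] := boolP (eta \in D2); first exact: P2.
    by have [] := P12 _ _ eta1 eta2 xi2 xi1.
  - by move=> /= xi2 eta2; apply: P2.
split=> /= [xi xiD||].
- split; first by apply/fsubsetP => x; apply: amalgam_hD.
  by split=> [|x]; [apply: amalgam_h_refl | apply: amalgam_h_le].
- apply: pair_ind => [xi eta xi1 eta1 ne|xi eta xi2 eta2 ne|].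
  + rewrite amalgam_i1 //; apply: fsubset_trans (fsubsetUl _ _).
    exact: i1D.
  + rewrite amalgam_i2 //; apply: fsubset_trans (fsubsetUr _ _).
    exact: i2D.
  + move=> xi eta xi1 xi2 eta2 eta1.
    rewrite (fsetUC [fset eta]%fset) amalgam_i_mixed //.
    by split=> _; apply/fsubsetP => x; rewrite !inE => /andP[].
- have clauses xi eta :
      covered amalgam_h (amalgam_i [fset xi; eta]%fset) xi eta ->
      [set` amalgam_i [fset xi; eta]%fset] `<=` f [fset xi; eta]%fset ->
    [/\ xi \in amalgam_h eta -> amalgam_h xi `\` amalgam_h eta `<=`
          \bigcup_(g <- amalgam_i [fset xi; eta]) amalgam_h g,
        xi \notin amalgam_h eta -> amalgam_h xi `&` amalgam_h eta `<=`
          \bigcup_(g <- amalgam_i [fset xi; eta]) amalgam_h g &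
        ([set` amalgam_i [fset xi; eta]] `<=` f [fset xi; eta])%classic]%fset.
    by move=> /coveredP[].
  apply: pair_ind => [xi eta xi1 eta1 lt|xi eta xi2 eta2 lt|].
  + apply: clauses; first exact: amalgam_covered1.
    by rewrite amalgam_i1 //; have [] := H1 _ _ xi1 eta1 lt.
  + apply: clauses; first exact: amalgam_covered2.
    by rewrite amalgam_i2 ?lt_eqF //; have [] := H2 _ _ xi2 eta2 lt.
  + move=> xi eta xi1 xi2 eta2 eta1.
    have sub : [set` amalgam_i [fset xi; eta]%fset] `<=` f [fset xi; eta]%fset.
      move=> x; rewrite /= amalgam_i_mixed // !inE /= => /andP[_].
      by rewrite in_setE.
    split=> lt; apply: clauses => //; first exact: amalgam_covered_mixed12.
      by rewrite fsetUC; apply: amalgam_covered_mixed21.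
    by rewrite fsetUC.
Qed.

Lemma amalgam_le1 : cond_le amalgam p1.
Proof.
split=> /= [|xi xi1|xi eta xi1 eta1 _]; first exact: fsubsetUl.
  apply/fsetP => x; rewrite inE; have [x1|x1] := boolP (x \in D1).
    by rewrite andbT amalgam_hE1 ?sub1 // collapse1_id.
  by rewrite andbF; apply/esym/negbTE; apply: contraNN x1 => /(h1_sub xi1).
exact: amalgam_i1.
Qed.

Lemma amalgam_le2 : cond_le amalgam p2.
Proof.
split=> /= [|xi xi2|xi eta xi2 eta2 ne]; first exact: fsubsetUr.
  apply/fsetP => x; rewrite inE; have [x2|x2] := boolP (x \in D2).
    by rewrite andbT amalgam_hE2 ?sub2 // collapse2_id.
  by rewrite andbF; apply/esym/negbTE; apply: contraNN x2 => /(h2_sub xi2).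
exact: amalgam_i2.
Qed.

Lemma amalgam_h_e xi eta : xi \in D1 -> eta \in D2 ->
  (xi \in amalgam_h eta) = (e xi \in h2 eta).
Proof.
by move=> xi1 eta2; rewrite amalgam_hE2 ?sub1 // /collapse2 xi1.
Qed.

End Amalgam.

Theorem lemma2p7 (d : Order.disp_t) (T : orderType d) (omega2T : is_omega2 T)
  (f : {fset T} -> set T) (Deltaf : property_Delta f)
  (p1 p2 : condition T) (Pp1 : in_forcing f p1) (Pp2 : in_forcing f p2)
  (isop : isomorphic p1 p2) (lowp : lower p1 p2)
  (e : T -> T) (bije : order_bij e (dom p1) (dom p2))
  (hA : forall xi eta : T,
     xi \in (dom p1 `&` dom p2)%fset -> eta \in (dom p1 `&` dom p2)%fset ->
     xi != eta -> ifun p1 [fset xi; eta] = ifun p2 [fset xi; eta])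
  (hB : forall xi eta : T,
     xi \in (dom p1 `\` dom p2)%fset -> eta \in (dom p2 `\` dom p1)%fset ->
     (forall zeta : T, zeta \in (dom p1 `&` dom p2)%fset -> zeta < xi ->
        f [fset zeta; eta] `<=` f [fset xi; eta]) /\
     [set` dom p1] `&` seg xi `&` seg eta `<=` f [fset xi; eta]) :
  exists q : condition T,
    [/\ in_forcing f q, cond_le q p1, cond_le q p2 &
        forall xi eta : T, xi \in dom p1 -> eta \in dom p2 ->
          (xi \in hfun q eta <-> e xi \in hfun p2 eta)].
Proof.
have [_ f_below _] := Deltaf; have [e' [iso' low']] := lowp.
have [bije' _ _] := iso'; have eE := order_bij_uniq bije bije'.
have mixedP xi eta : xi \in dom p1 -> xi \notin dom p2 ->
    eta \in dom p2 -> eta \notin dom p1 ->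
    xi \in (dom p1 `\` dom p2)%fset /\ eta \in (dom p2 `\` dom p1)%fset.
  by move=> ? ? ? ?; rewrite !inE; split; apply/andP.
exists (amalgam f p1 p2 e'); split.
- apply: amalgam_in_forcing => // [xi eta zeta|xi eta x] xi1 xi2 eta2 eta1.
    have [xiD etaD] := mixedP _ _ xi1 xi2 eta2 eta1.
    have [mono _] := hB _ _ xiD etaD.
    by move=> z1 z2; apply: mono; rewrite inE z1.
  have [xiD etaD] := mixedP _ _ xi1 xi2 eta2 eta1.
  by have [_ sub] := hB _ _ xiD etaD; move=> x1 xxi xeta; apply: sub.
- exact: amalgam_le1.
- exact: amalgam_le2.
- by move=> xi eta xi1 eta2; rewrite eE //= (amalgam_h_e f_below).
Qed.
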